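(* For every rooted tree $T$, the polynomial $P(T)$ is an irreducible element of $\mathbb{Z}[x,y]$.
   Context: All trees are finite and unlabeled. A rooted tree is a tree with one distinguished vertex (the root). $\bullet$ denotes the one-vertex rooted tree. For $k\ge 1$ and rooted trees $T_1,\dots,T_k$, $\wedge_k(T_1,\dots,T_k)$ denotes the rooted tree obtained by pasting the roots of $T_1,\dots,T_k$ to the $k$ leaf vertices of the rooted $k$-star (root with $k$ children), i.e. a new root whose $k$ children are the roots of $T_1,\dots,T_k$. Every rooted tree other than $\bullet$ is of this form, uniquely up to reordering and isomorphism of the $T_i$. The polynomial $P(T)\in\mathbb{Z}[x,y]$ of a rooted tree $T$ is defined recursively by $P(\bullet)=x$ and $P(\wedge_k(T_1,\dots,T_k))=y+\prod_{i=1}^k P(T_i)$ for $k\ge 1$. *)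

(* Defs.v *)
From HB Require Import structures.
From mathcomp Require Import all_boot all_order all_fingroup all_algebra.
From mathcomp Require Import mpoly.

Set Implicit Arguments.
Unset Strict Implicit.
Unset Printing Implicit Defensive.

Import GRing.Theory.
Local Open Scope ring_scope.

(* [Wedge k [T_0, ..., T_k]] is wedge_{k+1}(T_0, ..., T_k), so that the number  *)
(* of children of the root is always at least 1. The children carry an order;  *)
(* unlabeled rooted trees are the classes of [rtree] modulo [rtree_iso], and   *)
(* [rtree_poly_iso] shows that [rtree_poly] only depends on the class.         *)
Inductive rtree : Type :=
  | Bullet
  | Wedge (k : nat) (T : 'I_k.+1 -> rtree).

Inductive rtree_iso : rtree -> rtree -> Prop :=
  | IsoBullet : rtree_iso Bullet Bullet
  | IsoWedge k (T U : 'I_k.+1 -> rtree) (s : 'S_k.+1) :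
      (forall i, rtree_iso (T i) (U (s i))) -> rtree_iso (Wedge T) (Wedge U).

Local Notation Zxy := {mpoly int[2]}.
Definition var_x : Zxy := 'X_(ord0 : 'I_2).
Definition var_y : Zxy := 'X_(ord_max : 'I_2).

Fixpoint rtree_poly (t : rtree) : Zxy :=
  match t with
  | Bullet => var_x
  | Wedge k T => var_y + \prod_(i < k.+1) rtree_poly (T i)
  end.

Lemma rtree_poly_iso t u : rtree_iso t u -> rtree_poly t = rtree_poly u.
Proof.
elim=> // k T U s _ IH /=; congr (_ + _).
by rewrite [RHS](reindex_inj (@perm_inj _ s)); apply: eq_bigr.
Qed.

(* Irreducible element of a domain; polydiv's [irreducible_poly] is univariate *)
(* and ignores non-unit constant factors, so it does not apply to Z[x, y].     *)
Definition irreducible_elt (R : idomainType) (p : R) : Prop :=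
  [/\ p != 0, p \isn't a GRing.unit &
      forall a b : R, p = a * b -> a \is a GRing.unit \/ b \is a GRing.unit].

(* Main.v *)
Require Import Defs.
From mathcomp Require Import all_boot all_order all_fingroup all_algebra.
From mathcomp Require Import mpoly.

(** The proof is Eisenstein's criterion for [P(T)], seen as a polynomial in [x]
    over [Z[y]], at the prime [y].  Modulo [y] the recursion is the product
    over the children, so [P(T)] reduces to [x ^ l], with [l] the number of
    leaves of [T]; since that product has positive degree in [x], adding [y]
    to it does not change the leading coefficient, and [P(T)] is monic in [x].
    This is [Zyx_rtree_poly].  It remains to see that [y ^ 2] does not divide the
    constant term [P(T)(0, y)] when [T] is not the one-vertex tree.  The
    coefficient of [y] in it is in fact positive: the summand [y] contributes
    1, and the product contributes 0 if there are at least two children, since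
    each factor is a multiple of [y], and the coefficient of the only child,
    nonnegative by induction, otherwise ([coefy_rtree_poly]).  The criterion
    itself is [eisenstein]; the one-vertex tree gives [x], which is monic of
    degree one.

    The criterion lives in [{poly {poly int}}], the statement in
    [{mpoly int[2]}].  Factorizations are carried over by the morphism
    [to_Zyx], and units are carried back by its left inverse [of_Zyx]. *)

Set Implicit Arguments.
Unset Strict Implicit.
Unset Printing Implicit Defensive.

Import Order.TTheory GRing.Theory Num.Theory.
Local Open Scope ring_scope.

(** * Irreducibility criteria *)

(** The left inverse makes [f] injective and lets units be pulled back along
    it, so a factorization of [p] is as trivial as its image under [f]. *)
Lemma irreducible_retract (A B : idomainType)
    (f : {rmorphism A -> B}) (g : {rmorphism B -> A}) (p : A) :
  cancel f g -> irreducible_elt (f p) -> irreducible_elt p.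
Proof.
move=> fK [fp_neq0 fpNunit fp_irr]; split.
- by apply: contraNneq fp_neq0 => ->; rewrite rmorph0.
- by apply: contra fpNunit; apply: rmorph_unit.
move=> a b def_p.
have unit_back c : f c \is a GRing.unit -> c \is a GRing.unit.
  by move=> fcU; rewrite -(fK c) rmorph_unit.
have := fp_irr (f a) (f b); rewrite def_p rmorphM => /(_ erefl).
by case=> /unit_back; [left | right].
Qed.

Section Eisenstein.

Variable R : idomainType.
Implicit Types a b c d q : {poly R}.

(** Over a domain, the leading coefficients of the factors of a monic
    polynomial are inverse to each other. *)
Lemma monic_factor_lead_unit a b :
  a * b \is monic -> lead_coef a \is a GRing.unit.
Proof.
rewrite monicE lead_coefM => /eqP ab1.
by apply/unitrP; exists (lead_coef b); rewrite mulrC ab1.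
Qed.

Lemma monic_factor_const_unit a b :
  a * b \is monic -> size a = 1%N -> a \is a GRing.unit.
Proof.
move=> /monic_factor_lead_unit aU sz_a; rewrite poly_unitE sz_a eqxx /=.
by move: aU; rewrite lead_coefE sz_a.
Qed.

Lemma monic_linear_irreducible q :
  q \is monic -> size q = 2%N -> irreducible_elt q.
Proof.
move=> q_monic sz_q; split; first exact: monic_neq0.
  by rewrite poly_unitE sz_q.
move=> a b def_q; move: q_monic sz_q; rewrite {}def_q => ab_monic.
have := monic_neq0 ab_monic; rewrite mulf_eq0 negb_or => /andP[a0 b0].
rewrite size_mul // => sz_ab.
have := a0; have := b0; rewrite -!size_poly_gt0 => sb sa.
have [sz_a | sz_a] := eqVneq (size a) 1%N.
  by left; apply: monic_factor_const_unit ab_monic sz_a.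
right; apply: (@monic_factor_const_unit b a); first by rewrite mulrC.
move: sa sb sz_a sz_ab.
case: (size a) => [|[|m]] //; case: (size b) => [|[|k]] // _ _ _.
by rewrite addSn !addnS.
Qed.

(** As ['X] is prime and does not divide [c], the whole power ['X^n] divides
    the cofactor [d]. *)
Lemma size_factor_Xn (n : nat) c d :
  c * d = 'X^n -> c`_0 != 0 -> size c = 1%N.
Proof.
elim: n d => [|n IHn] d cd c0.
  have : c * d != 0 by rewrite cd expr0 oner_neq0.
  rewrite mulf_eq0 negb_or => /andP[cN0 dN0].
  have := size_mul cN0 dN0; rewrite cd expr0 size_poly1.
  move: cN0 dN0; rewrite -!size_poly_gt0.
  case: (size c) => [|[|k]] //; case: (size d) => [|m] // _ _.
  by rewrite addSn addnS.
have d0 : d`_0 = 0.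
  have := congr1 (fun p : {poly R} => p`_0) cd.
  rewrite coef0M coefXn /= => /eqP; rewrite mulf_eq0 (negPf c0) /=.
  by move/eqP.
have /factor_theorem[d' def_d] : root d 0 by rewrite rootE horner_coef0 d0.
apply: (IHn d') => //; apply: (@mulIf _ 'X); first by rewrite polyX_eq0.
by rewrite -exprSr -cd def_d subr0 mulrA.
Qed.

End Eisenstein.

(** Eisenstein's criterion at the prime ideal [P], the kernel of [e]: the last
    hypothesis follows from the usual one, that [q`_0] is not in [P ^ 2].  If
    both factors had their constant terms in [P], then [q`_0] would be such a
    product; so one factor is a nonzero constant modulo [P], hence a constant
    because its leading coefficient is a unit. *)
Lemma eisenstein (R S : idomainType) (e : {rmorphism R -> S})
    (n : nat) (q : {poly R}) :
    q \is monic -> map_poly e q = 'X^(n.+1) ->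
    (forall u v, e u = 0 -> e v = 0 -> q`_0 <> u * v) ->
  irreducible_elt q.
Proof.
move=> q_monic eq_q q0; split; first exact: monic_neq0.
  (* A unit has size 1, too small for its reduction to be ['X^(n.+1)]. *)
  apply/negP; rewrite poly_unitE => /andP[/eqP/esym sz_q _].
  have := size_poly (size q) (fun i => e q`_i).
  by rewrite -[\poly_(i < _) _]/(map_poly e q) eq_q size_polyXn -sz_q.
have nonzero_const_unit (a b : {poly R}) :
    q = a * b -> e a`_0 != 0 -> a \is a GRing.unit.
  move=> def_q ea0.
  have ab_monic : a * b \is monic by rewrite -def_q.
  apply: (monic_factor_const_unit ab_monic).
  rewrite -(@size_map_poly_id0 _ _ e).
    apply: (@size_factor_Xn _ n.+1 _ (map_poly e b)).
      by rewrite -rmorphM -def_q.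
    by rewrite coef_map.
  have /(rmorph_unit e) := monic_factor_lead_unit ab_monic.
  by apply: contraTneq => ->; rewrite unitr0.
move=> a b def_q.
have [ea0 | ea0] := eqVneq (e a`_0) 0; last first.
  by left; apply: nonzero_const_unit def_q ea0.
have [eb0 | eb0] := eqVneq (e b`_0) 0; last first.
  by right; apply: (nonzero_const_unit b a) eb0; rewrite mulrC.
by case: (q0 _ _ ea0 eb0); rewrite def_q coef0M.
Qed.

(** * Passing from Z[x, y] to Z[y][x] *)

(** A ring morphism is determined on the coefficients, which are integers. *)
Lemma mpoly_int_rmorph_ext (n : nat) (S : comNzRingType)
    (f g : {rmorphism {mpoly int[n]} -> S}) :
  (forall i, f 'X_i = g 'X_i) -> f =1 g.
Proof.
move=> fg p; rewrite (mpolyE p) !rmorph_sum /=; apply: eq_bigr => m _.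
rewrite -[p@_m]intz scaler_int !rmorphMz; congr (_ *~ _).
rewrite mpolyXE_id !rmorph_prod; apply: eq_bigr => i _.
by rewrite !rmorphXn /= fg.
Qed.

Local Notation Zxy := {mpoly int[2]}.
Local Notation Zyx := {poly {poly int}}.

Definition to_Zyx : {rmorphism Zxy -> Zyx} :=
  mmap (intr : int -> Zyx) (fun i : 'I_2 => if i == ord0 then 'X else 'X%:P).

Definition y_of_Zyx : {rmorphism {poly int} -> Zxy} :=
  horner_eval var_y \o map_poly (intr : int -> Zxy).

Definition of_Zyx : {rmorphism Zyx -> Zxy} :=
  horner_eval var_x \o map_poly y_of_Zyx.

Lemma to_Zyx_x : to_Zyx var_x = 'X.
Proof. by rewrite /to_Zyx /= mmapX mmap1U. Qed.

Lemma to_Zyx_y : to_Zyx var_y = 'X%:P.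
Proof. by rewrite /to_Zyx /= mmapX mmap1U. Qed.

Lemma to_ZyxK : cancel to_Zyx of_Zyx.
Proof.
apply: (mpoly_int_rmorph_ext (f := of_Zyx \o to_Zyx) (g := idfun)) => i /=.
have [-> | ->] : i = ord0 \/ i = ord_max.
- by case: i => [[|[|]]] // i_lt; [left | right]; apply: val_inj.
- by rewrite -/var_x to_Zyx_x /of_Zyx /= map_polyX /horner_eval hornerX.
rewrite -/var_y to_Zyx_y /of_Zyx /= map_polyC /horner_eval hornerC /=.
by rewrite map_polyX /horner_eval hornerX.
Qed.

(** * Eisenstein's hypotheses for the tree polynomials *)

Lemma to_Zyx_Wedge k (T : 'I_k.+1 -> rtree) :
  to_Zyx (rtree_poly (Wedge T))
  = 'X%:P + \prod_(i < k.+1) to_Zyx (rtree_poly (T i)).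
Proof. by rewrite /= rmorphD rmorph_prod to_Zyx_y. Qed.

Fixpoint nleaves (t : rtree) : nat :=
  match t with
  | Bullet => 1%N
  | Wedge k T => (\sum_(i < k.+1) nleaves (T i))%N
  end.

Lemma nleaves_gt0 t : (0 < nleaves t)%N.
Proof.
elim: t => [|k T IH] //=.
by rewrite big_ord_recl addn_gt0 IH.
Qed.

Local Notation mod_y := (coefp 0 : {rmorphism {poly int} -> int}).

Lemma Zyx_rtree_poly t :
  to_Zyx (rtree_poly t) \is monic /\
  map_poly mod_y (to_Zyx (rtree_poly t)) = 'X^(nleaves t).
Proof.
elim: t => [|k T IH].
  by rewrite [rtree_poly _]/= to_Zyx_x monicX map_polyX expr1.
rewrite to_Zyx_Wedge; set Q := \prod_i _.
have Q_monic : Q \is monic by apply: monic_prod => i _; case: (IH i).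
have Q_mod : map_poly mod_y Q = 'X^(nleaves (Wedge T)).
  rewrite /Q rmorph_prod /= expr_sum; apply: eq_bigr => i _.
  by case: (IH i).
split; last first.
  have Y_mod : map_poly mod_y 'X%:P = 0 by rewrite map_polyC /= coefX.
  by rewrite rmorphD [X in X + _]Y_mod [X in _ + X]Q_mod add0r.
have Q_size : (1 < size Q)%N.
  apply: leq_trans (size_poly (size Q) (fun i => mod_y Q`_i)).
  rewrite -[\poly_(i < _) _]/(map_poly mod_y Q) Q_mod size_polyXn ltnS.
  exact: nleaves_gt0.
rewrite monicE lead_coefDr ?(eqP Q_monic) //.
exact: leq_ltn_trans (size_polyC_leq1 _) Q_size.
Qed.

Lemma coef1M_kernel (u v : {poly int}) :
  mod_y u = 0 -> mod_y v = 0 -> (u * v)`_1 = 0.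
Proof.
rewrite /= => u0 v0.
by rewrite coefM !big_ord_recl big_ord0 /= u0 v0 mul0r mulr0 !addr0.
Qed.

Lemma mod_y_rtree_poly t : mod_y (to_Zyx (rtree_poly t))`_0 = 0.
Proof.
have [_ /(congr1 (fun p : {poly int} => p`_0))] := Zyx_rtree_poly t.
rewrite coef_map coefXn => ->.
by case: (nleaves t) (nleaves_gt0 t).
Qed.

(** The coefficient of [y] in [P(T)(0, y)] is 1 plus its value for the product
    of the children; the latter vanishes as soon as two factors are divisible
    by [y].  Only nonnegativity of the children is assumed because the
    one-vertex tree has coefficient 0. *)
Lemma coefy_Wedge k (T : 'I_k.+1 -> rtree) :
    (forall i, 0 <= (to_Zyx (rtree_poly (T i)))`_0`_1) ->
  0 < (to_Zyx (rtree_poly (Wedge T)))`_0`_1.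
Proof.
move=> T_ge0; rewrite to_Zyx_Wedge coefD coefC coefD coefX /=.
apply: ltr_wpDr => //.
case: k T T_ge0 => [|k] T T_ge0; first by rewrite big_ord1; apply: T_ge0.
rewrite big_ord_recl big_ord_recl !coef0M.
rewrite coef1M_kernel ?mod_y_rtree_poly //.
by rewrite [LHS]rmorphM [X in X * _]mod_y_rtree_poly mul0r.
Qed.

Lemma coefy_rtree_poly t : 0 <= (to_Zyx (rtree_poly t))`_0`_1.
Proof.
elim: t => [|k T IH]; last exact/ltW/coefy_Wedge.
by rewrite [rtree_poly _]/= to_Zyx_x coefX coef0.
Qed.

Theorem lemma2p6 (T : rtree) : irreducible_elt (rtree_poly T).
Proof.
apply: irreducible_retract to_ZyxK _.
case: T => [|k T].
  rewrite [rtree_poly _]/= to_Zyx_x.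
  by apply: monic_linear_irreducible; rewrite ?monicX ?size_polyX.
have [T_monic T_mod] := Zyx_rtree_poly (Wedge T).
apply: (eisenstein (e := mod_y) (n := (nleaves (Wedge T)).-1) T_monic).
  by rewrite prednK ?nleaves_gt0.
move=> u v u0 v0 def_uv.
have := @coefy_Wedge k T (fun i => coefy_rtree_poly (T i)).
by rewrite def_uv coef1M_kernel.
Qed.
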